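(* Let $p\ge2$ be an integer and let $\mathcal{G}=(\mathcal{V},\mathcal{E})$ be a $p$-cycle tree with edge labeling $c:\mathcal{E}\to\{1,\dots,p\}$. Denote its root by $\rho$; for $v\ne\rho$ let $\mathrm{par}(v)$ be the predecessor (parent) of $v$; for every vertex $v$ let $S(v)=(S(v)[0],S(v)[1],\dots)$ be a list of all successors (children) of $v$, each occurring exactly once, in an arbitrary but fixed order; let $k(v)$ be the distance of $v$ from the root. Define - $c(\rho):=1$ and $c(v):=c(\mathrm{par}(v)\,v)$ for $v\ne\rho$ (label of the edge entering $v$); - $o(\rho):=0$ and, for $v\ne\rho$, $o(v):=\sum_{i=0}^{j-1}c(S(\mathrm{par}(v))[i])$, where $j$ is the index with $S(\mathrm{par}(v))[j]=v$; - sequences $P(v)$ of nonnegative integers by $P(\rho):=(0)$ and, for $v\neq\rho$, $P(v):=\prod_{i=0}^{c(v)-1}\big(P(\mathrm{par}(v))+(o(v)+i)\,p^{k(v)-1}\big)$; - sequences $E(v)$ with entries in $\{0,\dots,p-1\}$ by $E(\rho):=(0)$ and, for $v\neq\rho$, $E(v):=\prod_{i=0}^{c(v)-1}(o(v)+i)^{|E(\mathrm{par}(v))|-1}\cdot\big(o(v)+((i+1)\,\%\,c(v))\big)$, where products and powers are concatenations of sequences (in $E(v)$, of one-element sequences), adding a number to a sequence is done entry-wise, and $|\cdot|$ denotes length. Then $$D\big[P(v)[i]+a\,p^{k(v)}\big]\big[k(v)-1\big]=E(v)[i]\qquad(\rho\neq v\in\mathcal{V},\ 0\le i<|P(v)|,\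 a\in\mathbb{Z}_p)$$ (well-)defines an infinite $p$-digit table $D$ with domain $\mathbb{Z}_p$ and block property. Let $F$ be the $p$-adic system in canonical form whose $F$-digit table is $D$, let $\pi:=\pi_{F,(x)^p}$ (a $p$-adic permutation), and let $$\varphi:\mathcal{V}\to\mathcal{V}(\pi),\qquad v\mapsto\Big(k(v),\ \text{the cycle }\big([P(v)[0]],\dots,[P(v)[|P(v)|-1]]\big)\text{ of }\pi_{k(v)}\Big).$$ Then $\varphi$ is an isomorphism between $\mathcal{G}$ and $\mathcal{G}(\pi)$ that respects the edge labelings $c$ and $c(\pi)$. In particular, $(\mathcal{G},c)$ and $(\mathcal{G}(\pi),c(\pi))$ are isomorphic.
   Context: $p\ge2$ is an integer, not necessarily prime. $\mathbb{Z}_p=\varprojlim \mathbb{Z}/p^k\mathbb{Z}$; every $a\in\mathbb{Z}_p$ is uniquely $a=\sum_{i\ge0}a_ip^i$ with $a_i\in\{0,\dots,p-1\}$, and $a\,\%\,p:=a_0$; for integers $a$ and $m\ge1$, $a\,\%\,m$ is the remainder in $\{0,\dots,m-1\}$. $p$-cycle tree: a directed, infinite, rooted tree (edges directed away from the root) with an edge labeling with values in $\{1,\dots,p\}$ such that all out-degrees lie in $\{1,\dots,p\}$, the out-degree of the root is $p$, and the labels of all outgoing edges of any given vertex sum up to $p$. Infinite $p$-digit table with domain $\mathbb{Z}_p$: a family $D=(D[n])_{n\in\mathbb{Z}_p}$ of infinite sequences $D[n]=(D[n][0],D[n][1],\dots)$ with entries in $\{0,\dots,p-1\}$ and $D[n][0]=n\,\%\,p$.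 Block property: for all $k\ge0$ and $m,n\in\mathbb{Z}_p$, $m\equiv n\pmod{p^k}$ iff the first $k$ entries of $D[m]$ and $D[n]$ coincide. A $p$-fibred function with domain $\mathbb{Z}_p$ is a $p$-tuple $F=(F[0],\dots,F[p-1])$ of functions $\mathbb{Z}_p\to\mathbb{Z}_p$, regarded also as a function by $F(n)=\big(F[n\%p](n)-(F[n\%p](n)\%p)\big)/p$. Its $F$-digit table is the family of sequences $\psi_F(n)=(F^k(n)\%p)_{k\ge0}$, $n\in\mathbb{Z}_p$. $F$ is a $p$-adic system if its $F$-digit table has the block property. $F$ is in canonical form if $F[r](n)\in p\mathbb{Z}_p$ when $n\equiv r\pmod p$ and $F[r](n)=0$ when $n\not\equiv r\pmod p$. Every infinite $p$-digit table with domain $\mathbb{Z}_p$ and block property is the $F$-digit table of a unique $p$-adic system $F$ in canonical form. $(x)^p=(x,\dots,x)$ is the $p$-adic system whose digit expansions are the usual base $p$ expansions. For $p$-adic systems $F,G$, $\psi_F,\psi_G$ are bijections onto the set of infinite sequences over $\{0,\dots,p-1\}$, and $\pi_{F,G}:=\psi_G^{-1}\circ\psi_F$. A $p$-adic permutation is a permutation $\pi$ of $\mathbb{Z}_p$ with $\pi(n)\equiv n\pmod p$ for all $n$ and $m\equiv n\pmod{p^k}\Leftrightarrow\pi(m)\equiv\pi(n)\pmod{p^k}$ for all $k\ge1$, $m,n\in\mathbb{Z}_p$. It induces permutations $\pi_k$ of $\mathbb{Z}_p/p^k\mathbb{Z}_p$, $[n]\mapsto[\pi(n)]$, $k\ge0$.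 Cycles (including fixed points) are finite sequences, each entry being mapped to the cyclically next one, up to cyclic shift; $|\sigma|$ is the length of the cycle $\sigma$. The tree of cycles of $\pi$ is the directed graph $\mathcal{G}(\pi)=(\mathcal{V}(\pi),\mathcal{E}(\pi))$ with $\mathcal{V}(\pi)=\{(k,\sigma)\mid k\in\mathbb{N}_0,\ \sigma\text{ a cycle of }\pi_k\}$ and an edge from $(k,\sigma)$ to $(\ell,\tau)$ iff $\ell=k+1$ and, writing $\sigma=([a_0],\dots,[a_{r-1}])$, $\tau=([b_0],\dots,[b_{s-1}])$, there is $i\in\mathbb{Z}$ such that $a_{j\%r}\equiv b_{(i+j)\%s}\pmod{p^k}$ for all $j\in\mathbb{Z}$. The edge labeling $c(\pi)$ assigns to the edge from $(k,\sigma)$ to $(k+1,\tau)$ the number $|\tau|/|\sigma|$. *)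

(* Defs.v *)
From HB Require Import structures.
From mathcomp Require Import all_boot all_order all_algebra.
From mathcomp Require Import generic_quotient ring_quotient.
From mathcomp Require Import boolp classical_sets functions cardinality.
Set Implicit Arguments.
Unset Strict Implicit.
Unset Printing Implicit Defensive.
Import GRing.Theory.
Local Open Scope ring_scope.
Local Open Scope quotient_scope.

(* Z_p is the inverse limit of the rings Z/p^(k+1), k >= 0, inside their
   product.  The trivial ring Z/p^0 is left out of the system: it does not
   change the limit, and 'Z_1 would denote Z/2. *)
Definition residues (p : nat) : Type := forall k : nat, 'Z_(p ^ k.+1).

(* No primality or positivity assumption on p is needed for this:
   Zp_trunc makes 'Z_m the ring Z/2 when m < 2. *)
Lemma Zp_trunc_exp_dvd (p k : nat) :
  ((Zp_trunc (p ^ k.+1)).+2 %| (Zp_trunc (p ^ k.+2)).+2)%N.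
Proof.
case: p => [|[|q]]; [by rewrite !exp0n | by rewrite !exp1n |].
have gt1 j : (1 < q.+2 ^ j.+1)%N by rewrite -(exp1n j.+1) ltn_exp2r.
by rewrite !Zp_cast // dvdn_exp2l.
Qed.

Lemma natr_modn_exp (p k n : nat) :
  (n %% (Zp_trunc (p ^ k.+2)).+2)%:R = n%:R :> 'Z_(p ^ k.+1).
Proof. by apply: val_inj; rewrite !Zp_nat /= modn_dvdm // Zp_trunc_exp_dvd. Qed.

Section Residues.
Variable p : nat.
Implicit Types x y z : residues p.

HB.instance Definition _ := Choice.copy (residues p) (forall k : nat, 'Z_(p ^ k.+1)).

Let zero : residues p := fun=> 0.
Let one : residues p := fun=> 1.
Let opp x : residues p := fun k => - x k.
Let add x y : residues p := fun k => x k + y k.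
Let mul x y : residues p := fun k => x k * y k.

Fact residues_addA : associative add.
Proof. by move=> x y z; apply: functional_extensionality_dep => k; exact: addrA. Qed.
Fact residues_addC : commutative add.
Proof. by move=> x y; apply: functional_extensionality_dep => k; exact: addrC. Qed.
Fact residues_add0 : left_id zero add.
Proof. by move=> x; apply: functional_extensionality_dep => k; exact: add0r. Qed.
Fact residues_addN : left_inverse zero opp add.
Proof. by move=> x; apply: functional_extensionality_dep => k; exact: addNr. Qed.

HB.instance Definition _ := GRing.isZmodule.Build (residues p)
  residues_addA residues_addC residues_add0 residues_addN.

Fact residues_mulA : associative mul.
Proof. by move=> x y z; apply: functional_extensionality_dep => k; exact: mulrA. Qed.
Fact residues_mulC : commutative mul.
Proof. by move=> x y; apply: functional_extensionality_dep => k; exact: mulrC. Qed.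
Fact residues_mul1 : left_id one mul.
Proof. by move=> x; apply: functional_extensionality_dep => k; exact: mul1r. Qed.
Fact residues_mulD : left_distributive mul add.
Proof. by move=> x y z; apply: functional_extensionality_dep => k; exact: mulrDl. Qed.
Fact residues_one_neq0 : one != 0.
Proof.
apply/eqP => /(congr1 (fun f : residues p => f 0)) /eqP.
by rewrite (negbTE (oner_neq0 _)).
Qed.

HB.instance Definition _ := GRing.Zmodule_isComNzRing.Build (residues p)
  residues_mulA residues_mulC residues_mul1 residues_mulD residues_one_neq0.

Definition coherent : pred (residues p) :=
  fun x => `[< forall k, (x k.+1 : nat)%:R = x k >].

Fact coherent_subring : subring_closed coherent.
Proof.
split=> [|x y|x y].
- by rewrite unfold_in; apply/asboolP => k; rewrite -natr_modn_exp modn_small.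
- rewrite !unfold_in => /asboolP cx /asboolP cy; apply/asboolP => k.
  have -> : (x - y) k = x k - y k by [].
  apply: (addIr (y k)); rewrite subrK -cx -[in LHS]cy.
  have -> : (x - y) k.+1 = x k.+1 - y k.+1 by [].
  rewrite -natrD -natr_modn_exp; congr (_%:R).
  by rewrite -[in RHS](subrK (y k.+1) (x k.+1)).
- rewrite !unfold_in => /asboolP cx /asboolP cy; apply/asboolP => k.
  have -> : (x * y) k = x k * y k by [].
  by rewrite -(cx k) -(cy k) -natrM -[RHS]natr_modn_exp.
Qed.

HB.instance Definition _ := GRing.isSubringClosed.Build (residues p) coherent
  coherent_subring.

End Residues.

Record padic (p : nat) : Type :=
  Padic { padic_val : residues p; _ : padic_val \in @coherent p }.

Section Padic.
Variable p : nat.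

HB.instance Definition _ := [isSub for @padic_val p].
HB.instance Definition _ := [Choice of padic p by <:].
HB.instance Definition _ := [SubChoice_isSubComNzRing of padic p by <:].

(* p^k Z_p *)
Definition pow_ideal (k : nat) : {pred padic p} :=
  fun n => `[< exists a, n = a * p%:R ^+ k >].

Fact pow_ideal_zmod_closed k : zmod_closed (pow_ideal k).
Proof.
split=> [|x y]; rewrite !unfold_in.
  by apply/asboolP; exists 0; rewrite mul0r.
move=> /asboolP[a ->] /asboolP[b ->]; apply/asboolP.
by exists (a - b); rewrite mulrBl.
Qed.

HB.instance Definition _ k := GRing.isZmodClosed.Build (padic p) (pow_ideal k)
  (pow_ideal_zmod_closed k).

Definition congr_pow (k : nat) (m n : padic p) : Prop := m - n \in pow_ideal k.

(* Z_p / p^k Z_p *)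
Definition padic_mod (k : nat) : choiceType := Quotient.quot (pow_ideal k).

Definition cls (k : nat) (n : padic p) : padic_mod k := \pi_(padic_mod k) n.

End Padic.

(* n % p *)
Definition digit (p : nat) (n : padic p) : 'Z_p := (padic_val n 0 : nat)%:R.

(* The digits {0, ..., p-1} are the elements of 'Z_p, for p >= 2. *)
Definition digit_family (p : nat) : Type := padic p -> nat -> 'Z_p.

Definition digit_table (p : nat) (D : digit_family p) : Prop :=
  forall n, D n 0%N = digit n.

Definition block_property (p : nat) (D : digit_family p) : Prop :=
  forall k m n, congr_pow k m n <-> (forall j, (j < k)%N -> D m j = D n j).

Definition fibred (p : nat) : Type := 'Z_p -> padic p -> padic p.

Section Fibred.
Variable p : nat.
Implicit Type F G : fibred p.

(* The quotient of n by p when n lies in p Z_p; p is not a zero divisor. *)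
Definition div_p (n : padic p) : padic p := xget 0 [set m | p%:R * m = n]%classic.

Definition fibred_fun F (n : padic p) : padic p :=
  let x := F (digit n) n in div_p (x - (digit x : nat)%:R).

Definition psi F : digit_family p := fun n k => digit (iter k (fibred_fun F) n).

Definition padic_system F : Prop := block_property (psi F).

Definition canonical_form F : Prop :=
  forall r n, (digit n = r -> F r n \in pow_ideal 1) /\
              (digit n <> r -> F r n = 0).

(* (x)^p *)
Definition base_system : fibred p := fun _ n => n.

(* pi_{F,G} = psi_G^-1 o psi_F; the first argument of 'pinv_ is a junk function, unused
   when psi G is onto. *)
Definition pi_sys F G : padic p -> padic p :=
  'pinv_(fun=> 0) [set: padic p] (psi G) \o psi F.

End Fibred.

Arguments base_system : clear implicits.

Section CyclicSequences.
Variable T : choiceType.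

Definition rot_equiv (s t : seq T) : bool := `[< exists i, t = rot i s >].

Fact rot_equiv_class : equiv_class_of rot_equiv.
Proof.
have sym s t : rot_equiv s t -> rot_equiv t s.
  by move=> /asboolP[i ->]; apply/asboolP; exists (size (rot i s) - i)%N;
     rewrite -/(rotr i _) rotK.
split=> [s|s t|t s u].
- by apply/asboolP; exists 0%N; rewrite rot0.
- by apply/idP/idP; exact: sym.
- move=> /asboolP[i ->] /asboolP[j ->]; apply/asboolP.
  have [n [lt_n ->]] : exists n, (n <= size s)%N /\ rot i s = rot n s.
    case: (leqP i (size s)) => [le_i|/ltnW ge_i]; first by exists i.
    by exists 0%N; rewrite rot0 rot_oversize.
  have [m [lt_m ->]] : exists m, (m <= size s)%N /\ rot j (rot n s) = rot m (rot n s).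
    case: (leqP j (size s)) => [le_j|/ltnW ge_j]; first by exists j.
    by exists 0%N; rewrite rot0 rot_oversize // size_rot.
  by rewrite rot_add_mod //; eexists.
Qed.

Canonical rot_equiv_equiv := EquivRelPack rot_equiv_class.
Canonical rot_equiv_encModRel := defaultEncModRel rot_equiv.

(* Finite sequences up to cyclic shift. *)
Definition cycseq : choiceType := {eq_quot rot_equiv}.

Definition to_cycseq (s : seq T) : cycseq := \pi_cycseq s.

(* [size] is invariant under cyclic shifts. *)
Definition cyc_length (sigma : cycseq) : nat := size (repr sigma).

Definition is_cycle (f : T -> T) (sigma : cycseq) : Prop :=
  exists s, [/\ sigma = to_cycseq s, (0 < size s)%N, uniq s & fcycle f s].

End CyclicSequences.

Record digraph : Type := Digraph { vert :> choiceType; edge : rel vert }.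

Definition rooted_tree (G : digraph) (rho : G) : Prop :=
  forall v : G, exists! s : seq G, path (@edge G) rho s /\ last rho s = v.

Definition children_list (G : digraph) (v : G) (s : seq G) : Prop :=
  uniq s /\ forall w, (w \in s) = edge v w.

(* [c v w] is the label of the edge [v w]; off the edges it is irrelevant. *)
Definition cycle_tree (p : nat) (G : digraph) (rho : G) (c : G -> G -> nat) : Prop :=
  [/\ rooted_tree rho,
      infinite_set [set: G]%classic,
      forall v w, edge v w -> (1 <= c v w <= p)%N &
      forall v, exists s, [/\ children_list v s,
        (1 <= size s <= p)%N,
        v = rho -> size s = p &
        (\sum_(w <- s) c v w = p)%N]].

Definition labelled_iso (G H : digraph) (c : G -> G -> rat) (d : H -> H -> rat)
    (phi : G -> H) : Prop :=
  [/\ bijective phi,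
      forall u v, edge u v = edge (phi u) (phi v) &
      forall u v, edge u v -> c u v = d (phi u) (phi v)].

Definition labelled_isomorphic (G H : digraph) (c : G -> G -> rat)
    (d : H -> H -> rat) : Prop :=
  exists phi : G -> H, labelled_iso c d phi.

Section TreeData.
Variables (p : nat) (G : digraph) (rho : G) (c : G -> G -> nat) (S : G -> seq G).

Definition par (v : G) : G := xget rho [set u | edge u v]%classic.

Definition root_path (v : G) : seq G :=
  xget [::] [set s | path (@edge G) rho s /\ last rho s = v]%classic.

(* In a rooted tree, the distance from the root is the length of the unique path. *)
Definition depth (v : G) : nat := size (root_path v).

Definition cin (v : G) : nat := if v == rho then 1%N else c (par v) v.

Definition offset (v : G) : nat :=
  if v == rho then 0%N else
  (\sum_(0 <= i < index v (S (par v))) cin (nth rho (S (par v)) i))%N.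

(* Recursion along the tree: [k] is to be instantiated with the depth of [v]. *)
Fixpoint Pseq_at (k : nat) (v : G) : seq nat :=
  if k is k'.+1 then
    flatten [seq [seq (x + (offset v + i) * p ^ k')%N | x <- Pseq_at k' (par v)]
            | i <- iota 0 (cin v)]
  else [:: 0%N].

Definition Pseq (v : G) : seq nat := Pseq_at (depth v) v.

Fixpoint Eseq_at (k : nat) (v : G) : seq nat :=
  if k is k'.+1 then
    flatten [seq nseq (size (Eseq_at k' (par v))).-1 (offset v + i)%N
                 ++ [:: (offset v + i.+1 %% cin v)%N]
            | i <- iota 0 (cin v)]
  else [:: 0%N].

Definition Eseq (v : G) : seq nat := Eseq_at (depth v) v.

Definition defines_table (D : digit_family p) : Prop :=
  forall (v : G) (i : nat) (a : padic p), v <> rho -> (i < size (Pseq v))%N ->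
    D ((nth 0%N (Pseq v) i)%:R + a * p%:R ^+ depth v) (depth v).-1
      = nth 0%N (Eseq v) i :> nat.

Hypothesis treeG : rooted_tree rho.

Lemma root_pathP v : path (@edge G) rho (root_path v) /\ last rho (root_path v) = v.
Proof.
have [s [hs _]] := treeG v.
exact: (@xgetPex _ [::] [set s | path (@edge G) rho s /\ last rho s = v]%classic
  (ex_intro _ s hs)).
Qed.

Lemma root_path_unique v s :
  path (@edge G) rho s -> last rho s = v -> s = root_path v.
Proof.
move=> ps ls; have [t [_ tu]] := treeG v.
by rewrite -(tu s) // -(tu (root_path v)) //; exact: root_pathP.
Qed.

Lemma root_path_edge u v : edge u v -> root_path v = rcons (root_path u) v.
Proof.
move=> uv; have [pu lu] := root_pathP u; apply/esym.
by apply: root_path_unique; rewrite ?last_rcons // rcons_path pu lu.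
Qed.

Lemma root_path_root : root_path rho = [::].
Proof. by apply/esym; apply: root_path_unique. Qed.

Lemma par_edge v : v <> rho -> edge (par v) v.
Proof.
move=> nv; apply: (@xgetPex _ rho [set u | edge u v]%classic) => /=.
have [] := root_pathP v; case/lastP: (root_path v) => [|s w]; first by move=> _ /= /esym.
by rewrite last_rcons rcons_path => /andP[_ e] <-; exists (last rho s).
Qed.

Lemma par_unique u v : edge u v -> u = par v.
Proof.
move=> uv.
have nv : v <> rho.
  by move=> ev; move: (root_path_edge uv); rewrite ev root_path_root; case: (root_path u).
have := root_path_edge uv; rewrite (root_path_edge (par_edge nv)) => /rcons_inj[e].
by rewrite -(root_pathP u).2 -e (root_pathP (par v)).2.
Qed.

Lemma depth_root : depth rho = 0%N.
Proof. by rewrite /depth root_path_root. Qed.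

Lemma depth_par v : v <> rho -> depth v = (depth (par v)).+1.
Proof. by move=> /par_edge e; rewrite /depth (root_path_edge e) size_rcons. Qed.

Lemma Pseq_root : Pseq rho = [:: 0%N].
Proof. by rewrite /Pseq depth_root. Qed.

Lemma PseqE v : v <> rho ->
  Pseq v = flatten [seq [seq (x + (offset v + i) * p ^ (depth v).-1)%N
                        | x <- Pseq (par v)] | i <- iota 0 (cin v)].
Proof. by move=> nv; rewrite /Pseq depth_par. Qed.

Lemma Eseq_root : Eseq rho = [:: 0%N].
Proof. by rewrite /Eseq depth_root. Qed.

Lemma EseqE v : v <> rho ->
  Eseq v = flatten [seq nseq (size (Eseq (par v))).-1 (offset v + i)%N
                        ++ [:: (offset v + i.+1 %% cin v)%N] | i <- iota 0 (cin v)].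
Proof. by move=> nv; rewrite /Eseq depth_par. Qed.

End TreeData.

Section TreeOfCycles.
Variables (p : nat) (f : padic p -> padic p).

Definition padic_perm : Prop :=
  [/\ bijective f,
      forall n, congr_pow 1 (f n) n &
      forall k m n, (1 <= k)%N -> (congr_pow k m n <-> congr_pow k (f m) (f n))].

(* The map [n] |-> [f n]; it does not depend on the representative when [f] is
   a p-adic permutation. *)
Definition induced (k : nat) (x : padic_mod p k) : padic_mod p k := cls k (f (repr x)).

Definition cycle_vertex : choiceType :=
  {x : {k : nat & cycseq (padic_mod p k)} |
     `[< is_cycle (@induced (tag x)) (tagged x) >]}.

Definition level (x : cycle_vertex) : nat := tag (val x).
Definition cycle_of (x : cycle_vertex) : cycseq (padic_mod p (level x)) :=
  tagged (val x).

Definition cycle_edge (x y : cycle_vertex) : Prop :=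
  level y = (level x).+1 /\
  exists a b : seq (padic p),
    [/\ cycle_of x = to_cycseq [seq cls (level x) n | n <- a],
        cycle_of y = to_cycseq [seq cls (level y) n | n <- b] &
        exists i : int, forall j : int,
          congr_pow (level x) (nth 0 a `|(j %% (size a)%:Z)%Z|%N)
                              (nth 0 b `|((i + j) %% (size b)%:Z)%Z|%N)].

Definition cycle_graph : digraph :=
  @Digraph cycle_vertex (fun x y => `[< cycle_edge x y >]).

Definition cycle_label (x y : cycle_graph) : rat :=
  (cyc_length (cycle_of y))%:R / (cyc_length (cycle_of x))%:R.

End TreeOfCycles.

(* Main.v *)
(* By induction on depth, the sequences P v with v of depth k are repetition-free
   and partition {0, ..., p^k - 1}: the p lifts of each entry of P u modulo p^(k+1)
   are shared out among the children w of u according to the blocks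
   [offset w, offset w + cin w) of the new digit.  Hence they are the cycles of a
   permutation step_k of Z/p^k, and the concatenation defining E says exactly that
   step_(k+1) lifts step_k, E w being the leading digit of its values.  The inverse
   limit of the step_k is a p-adic permutation f (f preserves the first digit
   because all children of the root have label 1), D n is the base p expansion of
   f n, and the system F is the base p shift conjugated by f.  Then
   pi_{F,(x)^p} = f, whose cycles modulo p^k are the P v by construction. *)
Require Import Defs.
From mathcomp Require Import all_boot all_order all_algebra.
From mathcomp Require Import generic_quotient ring_quotient zify.
From mathcomp Require Import boolp classical_sets functions cardinality.
Set Implicit Arguments.
Unset Strict Implicit.
Unset Printing Implicit Defensive.
Import GRing.Theory.
Local Open Scope ring_scope.

(** * Residues and base p digits of p-adic integers *)

Section PadicResidues.
Variables (p : nat) (hp : (1 < p)%N).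
Implicit Types (m n x y : padic p) (k : nat).

Lemma expn_p_gt0 k : (0 < p ^ k)%N.
Proof. by rewrite expn_gt0 (ltnW hp). Qed.

Lemma expn_p_gt1 k : (1 < p ^ k.+1)%N.
Proof. by rewrite -(exp1n k.+1) ltn_exp2r. Qed.

(** The canonical representative of [n] modulo p^k. Component [k'] of [padic_val] lives modulo
    p^(k'+1), hence the shift; level 0 is the trivial ring. *)
Definition res k n : nat := if k is k'.+1 then padic_val n k' else 0%N.

Lemma ltn_res k n : (res k n < p ^ k)%N.
Proof.
case: k => [|k]; first by [].
by rewrite /= -[X in (_ < X)%N](Zp_cast (expn_p_gt1 k)) ltn_ord.
Qed.

Lemma resS k n : (res k.+1 n %% p ^ k)%N = res k n.
Proof.
case: k => [|k]; first by rewrite modn1.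
have := valP n; rewrite unfold_in => /asboolP /(_ k) /(congr1 val) /=.
by rewrite (val_Zp_nat (expn_p_gt1 k)).
Qed.

Lemma res_mod k l n : (k <= l)%N -> (res l n %% p ^ k)%N = res k n.
Proof.
elim: l => [|l IH]; first by rewrite leqn0 => /eqP ->.
rewrite leq_eqVlt => /predU1P[->|lt_kl]; first by rewrite modn_small ?ltn_res.
by rewrite -(IH lt_kl) -(resS l) modn_dvdm // dvdn_exp2l.
Qed.

Lemma res_inj m n : (forall k, res k m = res k n) -> m = n.
Proof.
move=> h; apply: val_inj; apply: functional_extensionality_dep => k.
by apply: val_inj; exact: (h k.+1).
Qed.

Lemma resD k m n : res k (m + n) = ((res k m + res k n) %% p ^ k)%N.
Proof.
case: k => [|k]; first by rewrite modn1.
exact: (congr1 (modn _) (Zp_cast (expn_p_gt1 k))).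
Qed.

Lemma resM k m n : res k (m * n) = ((res k m * res k n) %% p ^ k)%N.
Proof.
case: k => [|k]; first by rewrite modn1.
exact: (congr1 (modn _) (Zp_cast (expn_p_gt1 k))).
Qed.

Lemma res1 k : res k 1 = (1 %% p ^ k)%N.
Proof.
case: k => [|k]; first by rewrite modn1.
by rewrite modn_small ?expn_p_gt1.
Qed.

Lemma res0 k : res k 0 = 0%N.
Proof. by case: k. Qed.

Lemma res_nat k (a : nat) : res k a%:R = (a %% p ^ k)%N.
Proof.
elim: a => [|a IH]; first by rewrite res0 mod0n.
by rewrite -natr1 resD IH res1 modnDm addn1.
Qed.

(** Completeness of Z_p: all p-adic integers built below (quotients by p^k, images and preimages
    under the permutation) come from here. *)
Lemma padic_lim (r : nat -> nat) : (forall k, (r k < p ^ k)%N) ->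
  (forall k, (r k.+1 %% p ^ k)%N = r k) -> exists n, forall k, res k n = r k.
Proof.
move=> ltr rS; pose x : residues p := fun k => (r k.+1)%:R.
have xE k : x k = r k.+1 :> nat.
  by rewrite /x (val_Zp_nat (expn_p_gt1 k)) modn_small.
have cx : x \in @coherent p.
  rewrite unfold_in; apply/asboolP => k; apply: val_inj => /=.
  by rewrite (val_Zp_nat (expn_p_gt1 k)) !xE rS.
exists (Padic cx) => -[|k] /=; last exact: xE.
by have := ltr 0%N; rewrite expn0; case: (r 0%N).
Qed.

Lemma resMp k l n : res (k + l) (n * p%:R ^+ l) = (res k n * p ^ l)%N.
Proof.
rewrite -natrX resM res_nat modnMmr expnD -muln_modl.
by rewrite res_mod // leq_addr.
Qed.

(** For the converse, the quotient of [n] by p^k is the limit of the exact quotients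
    [res (l + k) n %/ p ^ k]. *)
Lemma pow_idealP k n : n \in pow_ideal k <-> res k n = 0%N.
Proof.
rewrite unfold_in; split=> [/asboolP[a ->]|n0]; first by rewrite -(add0n k) resMp.
have dvd l : (p ^ k %| res (l + k) n)%N.
  by rewrite /dvdn (res_mod n (leq_addl l k)) n0.
apply/asboolP; have [|l|a aE] := @padic_lim (fun l => res (l + k) n %/ p ^ k)%N.
- by move=> l; rewrite ltn_divLR ?expn_p_gt0 // -expnD ltn_res.
- apply/eqP; rewrite -(eqn_pmul2r (expn_p_gt0 k)) muln_modl (divnK (dvd l)).
  by rewrite addSn -expnD (divnK (dvd l.+1)) resS.
exists a; apply: res_inj => l; case: (leqP k l) => [le_kl|lt_lk].
  by rewrite -(subnK le_kl) resMp aE divnK.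
(* Below level [k] both residues are reductions of a residue at level [k], which is 0. *)
rewrite -(res_mod n (ltnW lt_lk)) n0 mod0n -(res_mod _ (ltnW lt_lk)).
by rewrite -{1}(add0n k) resMp mod0n.
Qed.

Lemma resB_eq0 k m n : res k (m - n) = 0%N <-> res k m = res k n.
Proof.
split=> [h|h].
  by rewrite -[m](subrK n) resD h add0n modn_small ?ltn_res.
have : res k (m - n) + res k n = 0 + res k n %[mod p ^ k].
  by rewrite -resD subrK h add0n modn_small ?ltn_res.
move/eqP; rewrite eqn_modDr mod0n modn_small ?ltn_res //.
by move/eqP.
Qed.

Lemma congr_powP k m n : congr_pow k m n <-> res k m = res k n.
Proof. by rewrite /congr_pow pow_idealP resB_eq0. Qed.

Lemma cls_eqP k m n : cls k m = cls k n <-> res k m = res k n.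
Proof.
rewrite -congr_powP /congr_pow.
by split=> [/eqquotP|h]; [|apply/eqquotP]; rewrite Quotient.equivE.
Qed.

Lemma digitE n : digit n = res 1 n :> nat.
Proof.
rewrite /digit val_Zp_nat //; apply: modn_small.
rewrite -[X in (_ < X)%N](expn1 p); exact: (ltn_res 1 n).
Qed.

Lemma digit_eqP m n : digit m = digit n <-> res 1 m = res 1 n.
Proof. by rewrite -!digitE; split=> [->|/val_inj]. Qed.

Lemma ltn_digit (d : 'Z_p) : (d < p)%N.
Proof. by rewrite -[X in (_ < X)%N](Zp_cast hp) ltn_ord. Qed.

(** The residue of p n at level k+1 is p times the residue of n at level k, so p is not a zero
    divisor even for composite p. *)
Lemma mulp_inj : injective (fun n => p%:R * n).
Proof.
move=> m n /= e; apply: res_inj => k.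
have := congr1 (res k.+1) e; rewrite -{1 2}(addn1 k) !(mulrC p%:R) -(expr1 p%:R).
by rewrite !resMp expn1 => /eqP; rewrite eqn_pmul2r ?(ltnW hp) // => /eqP.
Qed.

Lemma pow_ideal1P n : n \in pow_ideal 1 <-> digit n = 0.
Proof.
rewrite pow_idealP -digitE; split=> [h|->] //.
by apply: val_inj.
Qed.

Lemma mulp_div n : digit n = 0 -> p%:R * div_p n = n.
Proof.
move=> /pow_ideal1P; rewrite unfold_in => /asboolP[a]; rewrite expr1 mulrC => na.
exact: (@xgetPex _ 0 [set m | p%:R * m = n]%classic (ex_intro _ a (esym na))).
Qed.

Lemma div_mulp n : div_p (p%:R * n) = n.
Proof.
apply: mulp_inj; apply: mulp_div; apply/pow_ideal1P.
by rewrite unfold_in; apply/asboolP; exists n; rewrite expr1 mulrC.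
Qed.

Lemma digit_nat (a : nat) : (a < p)%N -> digit (a%:R : padic p) = a :> nat.
Proof. by move=> ltap; rewrite digitE res_nat expn1 modn_small. Qed.

Lemma digit_sub_digit n : digit (n - (digit n : nat)%:R) = 0.
Proof.
apply: val_inj; rewrite /= digitE; apply/resB_eq0; rewrite -!digitE.
by rewrite digit_nat ?ltn_digit.
Qed.

Lemma fibred_funE (F : fibred p) n :
  let x := F (digit n) n in p%:R * fibred_fun F n = x - (digit x : nat)%:R.
Proof. by rewrite /= /fibred_fun mulp_div // digit_sub_digit. Qed.

(** * The usual base p expansion *)

Lemma base_funE n : n = (digit n : nat)%:R + p%:R * fibred_fun (base_system p) n.
Proof. by rewrite fibred_funE /base_system addrC subrK. Qed.

Lemma psiS (F : fibred p) n k : psi F n k.+1 = psi F (fibred_fun F n) k.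
Proof. by rewrite /psi iterSr. Qed.

Lemma res_base_sum k n :
  res k n = (\sum_(j < k) psi (base_system p) n j * p ^ j)%N.
Proof.
elim: k n => [|k IH] n; first by rewrite big_ord0.
rewrite big_ord_recl expn0 muln1 {1}(base_funE n) mulrC -(expr1 p%:R) resD.
rewrite -{2}(addn1 k) resMp expn1 res_nat modnDml IH big_distrl /=.
under [X in _ = (_ + X)%N]eq_bigr => j _ do rewrite /bump add1n psiS expnSr mulnA.
(* No carry: a digit is at most p - 1 and the remaining sum [s] is at most p^k - 1, so digit + p s <
   p^(k+1). *)
rewrite modn_small //.
have := ltn_res k (fibred_fun (base_system p) n); rewrite IH => lt_s.
have := ltn_digit (digit n); rewrite -[X in (digit n + X)%N]big_distrl /= expnSr.
move: (\sum_(j < k) _)%N lt_s => s; set q := (p ^ k)%N => ? ?; nia.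
Qed.

Lemma psi_base_eqP k m n :
  (forall j, (j < k)%N -> psi (base_system p) m j = psi (base_system p) n j) <->
  res k m = res k n.
Proof.
split=> [h|h j lt_jk].
  by rewrite !res_base_sum; apply: eq_bigr => -[j ltj] _; rewrite h.
have e l : (l <= k)%N -> res l m = res l n.
  by move=> le; rewrite -(res_mod m le) -(res_mod n le) h.
have := e j.+1 lt_jk; rewrite !res_base_sum !big_ord_recr /= -!res_base_sum.
rewrite (e j (ltnW lt_jk)) => /eqP.
by rewrite eqn_add2l eqn_pmul2r ?expn_p_gt0 // => /eqP/val_inj.
Qed.

Lemma psi_base_res k n :
  psi (base_system p) n k = (res k.+1 n %/ p ^ k)%N :> nat.
Proof.
rewrite res_base_sum big_ord_recr /= -res_base_sum addnC divnMDl ?expn_p_gt0 //.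
by rewrite divn_small ?ltn_res ?addn0.
Qed.

Lemma psi_base_inj : injective (psi (base_system p)).
Proof. by move=> m n e; apply: res_inj => k; apply/psi_base_eqP => j _; rewrite e. Qed.

End PadicResidues.

(** * The system attached to a p-adic permutation *)

Section PermutationSystem.
Variables (p : nat) (hp : (1 < p)%N) (f g : padic p -> padic p).
Hypotheses (fK : cancel f g) (gK : cancel g f).
Hypothesis f_res : forall k m n, res k m = res k n <-> res k (f m) = res k (f n).
Hypothesis f_digit : forall n, digit (f n) = digit n.

Let B : padic p -> padic p := fibred_fun (base_system p).

(** The factor p makes the division by p in [fibred_fun] return the conjugate of the base p shift
    [B] by [f]; the zero branch is forced by the canonical form. *)
Definition conj_system : fibred p :=
  fun r n => if digit n == r then p%:R * g (B (f n)) else 0.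

Lemma conj_fun n : fibred_fun conj_system n = g (B (f n)).
Proof.
rewrite /fibred_fun /conj_system eqxx.
have -> : digit (p%:R * g (B (f n))) = 0.
  apply/(pow_ideal1P hp); rewrite unfold_in; apply/asboolP.
  by exists (g (B (f n))); rewrite expr1 mulrC.
by rewrite subr0 div_mulp.
Qed.

(** [f] carries the orbit of [n] to the [B]-orbit of [f n] and leaves first digits unchanged. *)
Lemma psi_conj n : psi conj_system n = psi (base_system p) (f n).
Proof.
apply/funext => k; rewrite /psi -f_digit; congr digit; elim: k => //= k IH.
by rewrite conj_fun gK IH.
Qed.

Lemma conj_block : block_property (psi conj_system).
Proof.
move=> k m n; rewrite (congr_powP hp) f_res -(psi_base_eqP hp).
by rewrite !psi_conj.
Qed.

Lemma conj_canonical : canonical_form conj_system.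
Proof.
move=> r n; rewrite /conj_system; split=> [->|/eqP/negbTE -> //].
rewrite eqxx unfold_in; apply/asboolP.
by exists (g (B (f n))); rewrite expr1 mulrC.
Qed.

Lemma psi_conj_inj : injective (psi conj_system).
Proof.
move=> m n; rewrite !psi_conj => /(psi_base_inj hp).
exact: (can_inj fK).
Qed.

(** Applying the fibred function shifts the digit sequence, and digit sequences separate points, so
    equal tables give equal fibred functions. In canonical form [F r n] is p times the fibred
    function on its own residue class and 0 elsewhere. *)
Lemma conj_unique (F : fibred p) :
  canonical_form F -> psi F = psi conj_system -> F = conj_system.
Proof.
move=> canF eF.
have eB n : fibred_fun F n = fibred_fun conj_system n.
  by apply: psi_conj_inj; apply/funext => k; rewrite -{1}eF -!psiS eF.
apply/funext => r; apply/funext => n.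
have [ern|nrn] := eqVneq (digit n) r; last first.
  by rewrite (canF r n).2 ?(conj_canonical r n).2 //; apply/eqP.
have divE (H : fibred p) : canonical_form H -> H r n = p%:R * fibred_fun H n.
  move=> canH; have /(canH r n).1/(pow_ideal1P hp) H0 := ern.
  by rewrite (fibred_funE hp) ern H0 subr0.
by rewrite !divE ?eB //; exact: conj_canonical.
Qed.

Lemma pi_sys_conj : pi_sys conj_system (base_system p) = f.
Proof.
apply/funext => n; rewrite /pi_sys /= psi_conj pinvKV ?inE //.
by move=> x y _ _; exact: (psi_base_inj hp).
Qed.

End PermutationSystem.

(** * Consecutive blocks of integers, and concatenations of blocks of equal length *)

Section Sequences.
Variable T : eqType.
Implicit Types (s : seq T) (F : T -> nat).

(** The left end of the block of [w] when intervals of lengths [F] are laid end to end in the order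
    of [s]; this is the shape of [offset]. *)
Definition before (x0 : T) F s w :=
  (\sum_(0 <= i < index w s) F (nth x0 s i))%N.

Lemma before_succ x0 F s w : w \in s ->
  (\sum_(0 <= i < (index w s).+1) F (nth x0 s i))%N = (before x0 F s w + F w)%N.
Proof. by move=> ws; rewrite big_nat_recr //= nth_index. Qed.

Lemma sum_nth_le x0 F s i j : (i <= j)%N ->
  (\sum_(0 <= l < i) F (nth x0 s l) <= \sum_(0 <= l < j) F (nth x0 s l))%N.
Proof. by move=> le_ij; rewrite [leqRHS](big_cat_nat (leq0n i) le_ij) leq_addr. Qed.

Lemma before_le_sum x0 F s w : w \in s ->
  (before x0 F s w + F w <= \sum_(w <- s) F w)%N.
Proof.
by move=> ws; rewrite -(before_succ x0) // (big_nth x0) sum_nth_le // index_mem.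
Qed.

(** A block of larger index starts no earlier than the end of the other one, so a common point [t]
    bounds each index by the other. *)
Lemma block_unique x0 F s w w' t : w \in s -> w' \in s ->
  (before x0 F s w <= t < before x0 F s w + F w)%N ->
  (before x0 F s w' <= t < before x0 F s w' + F w')%N -> w = w'.
Proof.
have lt_index u u' : u \in s -> (t < before x0 F s u + F u)%N ->
    (before x0 F s u' <= t)%N -> (index u' s <= index u s)%N.
  move=> us ltt let'; rewrite leqNgt; apply/negP => lti.
  have := sum_nth_le x0 F s lti; rewrite before_succ //.
  by move=> le; have := leq_trans ltt (leq_trans le let'); rewrite ltnn.
move=> ws w's /andP[a1 a2] /andP[b1 b2].
apply: (index_inj w ws w's); apply/eqP.
by rewrite eqn_leq !lt_index.
Qed.

(** Induction on [s]: either [t] lies in the first block, or that block is removed and [t] is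
    lowered by its length. *)
Lemma block_exists x0 F s t : uniq s -> (t < \sum_(w <- s) F w)%N ->
  exists2 w, w \in s & (before x0 F s w <= t < before x0 F s w + F w)%N.
Proof.
elim: s t => [|x s IH] t; first by rewrite big_nil.
rewrite big_cons /= => /andP[xs us] lt_t.
have [lt_tx|le_xt] := ltnP t (F x).
  exists x; first exact: mem_head.
  by rewrite /before /= eqxx big_geq.
have [|w ws /andP[h1 h2]] := IH (t - F x)%N us; first by rewrite ltn_subLR.
have wx : x != w by apply: contraNneq xs => ->.
exists w; first by rewrite inE ws orbT.
rewrite /before /= (negbTE wx) big_nat_recl //=.
by move: h1 h2; rewrite /before; set X := (\sum_(_ <= _ < _) _)%N; lia.
Qed.

Lemma sum_eq_size F s w : {in s, forall w, (0 < F w)%N} ->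
  (\sum_(w <- s) F w)%N = size s -> w \in s -> F w = 1%N.
Proof.
move=> F1 + ws; rewrite (big_rem w ws) /=.
have : (size (rem w s) <= \sum_(y <- rem w s) F y)%N.
  rewrite -sum1_size big_seq [leqRHS]big_seq; apply: leq_sum => y ys.
  exact/F1/(mem_rem ys).
have : (0 < size s)%N by case: (s) ws.
by rewrite size_rem //; have := F1 w ws; lia.
Qed.

Lemma next_nth_mod x0 s i : uniq s -> (i < size s)%N ->
  next s (nth x0 s i) = nth x0 s (i.+1 %% size s).
Proof.
move=> us lti; rewrite next_nth mem_nth // index_uniq //.
case: s us lti => // y s us lti; have [lt|ge] := ltnP i (size s).
  by rewrite modn_small //=; apply: set_nth_default.
have -> : i = size s by move: lti => /=; lia.
by rewrite modnn /= nth_default.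
Qed.

Lemma nth_flatten_iota (F : nat -> seq T) x0 r n a j :
  (forall i, size (F i) = r) -> (j < r)%N -> (a < n)%N ->
  nth x0 (flatten [seq F i | i <- iota 0 n]) (a * r + j)%N = nth x0 (F a) j.
Proof.
move=> szF ltj; elim: a n F szF => [|a IH] [|n] F szF // lta /=.
  by rewrite nth_cat szF ltj.
rewrite nth_cat szF mulSn -addnA ltnNge leq_addr /= addKn.
rewrite -[1%N]addn0 iotaDl -map_comp.
exact: (IH n (fun i => F (1 + i)%N)).
Qed.

Lemma size_flatten_iota (F : nat -> seq T) r n :
  (forall i, size (F i) = r) -> size (flatten [seq F i | i <- iota 0 n]) = (n * r)%N.
Proof.
move=> szF; rewrite size_flatten /shape -map_comp.
rewrite (eq_map (g := fun=> r)) => [|i]; last exact: szF.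
by rewrite sumnE big_map big_const_seq count_predT size_iota iter_addn addn0 mulnC.
Qed.

End Sequences.

(** * The permutations of residues attached to a cycle tree *)

Section CycleTree.
Variables (p : nat) (hp : (1 < p)%N) (G : digraph) (rho : G) (c : G -> G -> nat).
Hypothesis hG : cycle_tree p rho c.
Variable S : G -> seq G.
Hypothesis hS : forall v, children_list v (S v).

Local Notation par := (par rho).
Local Notation depth := (depth rho).
Local Notation P := (Pseq p rho c S).
Local Notation E := (Eseq rho c S).
Local Notation cin := (cin rho c).
Local Notation offset := (offset rho c S).

Let treeG : rooted_tree rho. Proof. by case: hG. Qed.

(** * Edges, depths and labels of the tree *)

Lemma edge_not_root u v : edge u v -> v <> rho.
Proof.
move=> uv ev; have := root_path_edge treeG uv.
by rewrite ev root_path_root //; case: root_path.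
Qed.

Lemma edge_par u v : edge u v -> par v = u.
Proof. by move=> /(par_unique treeG). Qed.

Lemma depth_edge u v : edge u v -> depth v = (depth u).+1.
Proof. by move=> uv; rewrite (depth_par treeG (edge_not_root uv)) (edge_par uv). Qed.

Lemma cin_edge u v : edge u v -> cin v = c u v.
Proof.
by move=> uv; rewrite /cin (edge_par uv); case: eqP => // /(edge_not_root uv).
Qed.

Lemma offset_edge u v : edge u v -> offset v = before rho cin (S u) v.
Proof.
by move=> uv; rewrite /offset (edge_par uv); case: eqP => // /(edge_not_root uv).
Qed.

Lemma depth_eq0 v : depth v = 0%N -> v = rho.
Proof.
case: (pselect (v = rho)) => // nv; by rewrite (depth_par treeG nv).
Qed.

Lemma depthSP v k : depth v = k.+1 -> exists2 u, edge u v & depth u = k.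
Proof.
move=> dv; have nv : v <> rho by move=> ev; rewrite ev (depth_root treeG) in dv.
have e := par_edge treeG nv; exists (par v) => //.
by move: dv; rewrite (depth_edge e) => -[].
Qed.

Lemma tree_ind (Q : G -> Prop) :
  Q rho -> (forall u v, edge u v -> Q u -> Q v) -> forall v, Q v.
Proof.
move=> Q0 QS v; have [k] := ubnP (depth v); elim: k v => // k IH v.
case dv: (depth v) => [|l] lt; first by rewrite (depth_eq0 dv).
have [u uv du] := depthSP dv; by apply: (QS u v uv); apply: IH; rewrite du.
Qed.

Lemma cin_gt0 v : (0 < cin v)%N.
Proof.
case: (pselect (v = rho)) => [->|nv]; first by rewrite /cin eqxx.
have e := par_edge treeG nv; rewrite (cin_edge e).
by case: hG => _ _ /(_ _ _ e) /andP[].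
Qed.

Lemma mem_S u v : (v \in S u) = edge u v.
Proof. by case: (hS u). Qed.

(** [S u] is a permutation of the list of children provided by [cycle_tree], whose labels sum to
    p. *)
Lemma sum_cin u : (\sum_(w <- S u) cin w)%N = p.
Proof.
case: hG => _ _ _ /(_ u)[s [[us ms] _ _ <-]].
rewrite (perm_big s) /=; last first.
  by apply: uniq_perm => // [|w]; [case: (hS u) | rewrite mem_S ms].
rewrite big_seq [RHS]big_seq; apply: eq_bigr => w.
by rewrite ms => /cin_edge.
Qed.

(** The root has p children, whose positive labels sum to p. *)
Lemma cin_root_child w : edge rho w -> cin w = 1%N.
Proof.
rewrite -mem_S; apply: sum_eq_size => [v _|]; first exact: cin_gt0.
rewrite sum_cin; case: hG => _ _ _ /(_ rho)[s [[us ms] _ <- // _]].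
apply: perm_size; apply: uniq_perm => // [|v]; first by case: (hS rho).
by rewrite mem_S ms.
Qed.

Lemma offset_cin_le u v : edge u v -> (offset v + cin v <= p)%N.
Proof.
by move=> uv; rewrite -(sum_cin u) (offset_edge uv) before_le_sum ?mem_S.
Qed.

(** * Entries of [P] and [E], addressed by block [a] and position [j] in the block *)

Lemma PseqE_edge u v : edge u v ->
  P v = flatten [seq [seq (x + (offset v + i) * p ^ depth u)%N | x <- P u]
                | i <- iota 0 (cin v)].
Proof.
move=> uv; rewrite (PseqE _ _ _ treeG (edge_not_root uv)).
by rewrite (edge_par uv) (depth_edge uv).
Qed.

Lemma EseqE_edge u v : edge u v ->
  E v = flatten [seq nseq (size (E u)).-1 (offset v + i)%N
                        ++ [:: (offset v + i.+1 %% cin v)%N] | i <- iota 0 (cin v)].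
Proof.
by move=> uv; rewrite (EseqE _ _ treeG (edge_not_root uv)) (edge_par uv).
Qed.

Lemma size_Pseq u v : edge u v -> size (P v) = (cin v * size (P u))%N.
Proof.
by move=> uv; rewrite (PseqE_edge uv); apply: size_flatten_iota => i; rewrite size_map.
Qed.

Lemma size_Pseq_gt0 v : (0 < size (P v))%N.
Proof.
elim/tree_ind: v => [|u v uv IH]; first by rewrite Pseq_root.
by rewrite (size_Pseq uv) muln_gt0 cin_gt0.
Qed.

Lemma size_Eseq v : size (E v) = size (P v).
Proof.
elim/tree_ind: v => [|u v uv IH]; first by rewrite Pseq_root // Eseq_root.
rewrite (size_Pseq uv) (EseqE_edge uv); apply: size_flatten_iota => i.
by rewrite size_cat size_nseq addn1 IH prednK // size_Pseq_gt0.
Qed.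

Lemma nth_Pseq u v a j : edge u v -> (a < cin v)%N -> (j < size (P u))%N ->
  nth 0%N (P v) (a * size (P u) + j) =
  (nth 0%N (P u) j + (offset v + a) * p ^ depth u)%N.
Proof.
move=> uv lta ltj; rewrite (PseqE_edge uv) nth_flatten_iota ?(nth_map 0%N) //.
by move=> i; rewrite size_map.
Qed.

(** The new digit stays constant along a copy of [P u] and changes only at its last position, where
    the cycle passes to the next copy, cyclically. *)
Lemma nth_Eseq u v a j : edge u v -> (a < cin v)%N -> (j < size (P u))%N ->
  nth 0%N (E v) (a * size (P u) + j) =
  (offset v + (if j.+1 == size (P u) then a.+1 %% cin v else a))%N.
Proof.
move=> uv lta ltj; rewrite (EseqE_edge uv) size_Eseq nth_flatten_iota //; last first.
  by move=> i; rewrite size_cat size_nseq addn1 prednK // size_Pseq_gt0.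
rewrite nth_cat size_nseq nth_nseq.
case: eqP => [<-|ne]; first by rewrite ltnn subnn.
by have -> : (j < (size (P u)).-1)%N by lia.
Qed.

Lemma Pseq_index u v i : edge u v -> (i < size (P v))%N ->
  exists a j, [/\ i = (a * size (P u) + j)%N, (a < cin v)%N & (j < size (P u))%N].
Proof.
move=> uv; rewrite (size_Pseq uv) => lti.
exists (i %/ size (P u))%N, (i %% size (P u))%N; split; first exact: divn_eq.
- by rewrite ltn_divLR // size_Pseq_gt0.
- by rewrite ltn_pmod // size_Pseq_gt0.
Qed.

Lemma Pseq_lt v : all (fun x => (x < p ^ depth v)%N) (P v).
Proof.
elim/tree_ind: v => [|u v uv /(all_nthP 0%N) IH].
  by rewrite Pseq_root // depth_root.
apply/(all_nthP 0%N) => i /(Pseq_index uv)[a [j [-> lta ltj]]].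
rewrite (nth_Pseq uv) // (depth_edge uv) expnS.
have := IH j ltj; have := offset_cin_le uv.
by move: (p ^ depth u)%N (nth _ _ _) => q y; nia.
Qed.

Lemma nth_Pseq_lt v i : (i < size (P v))%N -> (nth 0%N (P v) i < p ^ depth v)%N.
Proof. by move=> lti; apply: (allP (Pseq_lt v)); exact: mem_nth. Qed.

Lemma Eseq_lt v : all (fun e => (e < p)%N) (E v).
Proof.
elim/tree_ind: v => [|u v uv _]; first by rewrite Eseq_root //= ltnW.
apply/(all_nthP 0%N) => i; rewrite size_Eseq => /(Pseq_index uv)[a [j [-> lta ltj]]].
rewrite (nth_Eseq uv) //; have := offset_cin_le uv.
have := ltn_pmod a.+1 (cin_gt0 v).
by case: ifP; lia.
Qed.

(** Reduction modulo p^(depth u) recovers [j] by induction; the leading digit then recovers [a]. *)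
Lemma uniq_Pseq v : uniq (P v).
Proof.
elim/tree_ind: v => [|u v uv IH]; first by rewrite Pseq_root.
apply/(uniqP 0%N) => i i'; rewrite !inE.
move=> /(Pseq_index uv)[a [j [-> lta ltj]]] /(Pseq_index uv)[a' [j' [-> lta' ltj']]].
rewrite !(nth_Pseq uv) // => e.
have lt1 := nth_Pseq_lt ltj; have lt2 := nth_Pseq_lt ltj'.
have ej : j = j'.
  apply/eqP; rewrite -(nth_uniq 0%N ltj ltj' IH).
  move/(congr1 (modn^~ (p ^ depth u)%N)): e.
  by rewrite !(addnC (nth _ _ _)) !modnMDl !modn_small // => ->.
move: e; rewrite ej => /addnI/eqP.
by rewrite eqn_pmul2r ?expn_p_gt0 // => /eqP/addnI ->.
Qed.

(** The low digits decide membership for the parent and the leading digit selects the child;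
    covering and disjointness both follow from this. *)
Lemma mem_Pseq u v x : edge u v ->
  (x \in P v) = (x %% p ^ depth u \in P u)%N &&
                (offset v <= x %/ p ^ depth u < offset v + cin v)%N.
Proof.
move=> uv; apply/idP/idP => [/(nthP 0%N)[i /(Pseq_index uv)[a [j [-> lta ltj]]] <-]|].
  rewrite (nth_Pseq uv) // addnC modnMDl divnMDl ?expn_p_gt0 //.
  rewrite modn_small ?nth_Pseq_lt // divn_small ?nth_Pseq_lt // mem_nth //.
  by rewrite addn0 leq_addr ltn_add2l.
case/andP=> /(nthP 0%N)[j ltj ej] /andP[le lt].
(* The block number is the leading digit relative to [offset v]; [j] locates the low part in
   [P u]. *)
apply/(nthP 0%N); exists ((x %/ p ^ depth u - offset v) * size (P u) + j)%N.
  rewrite (size_Pseq uv).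
  have : (x %/ p ^ depth u - offset v < cin v)%N by lia.
  by move: (_ - _)%N (size _) ltj => a r; nia.
rewrite (nth_Pseq uv) //; last by lia.
by rewrite ej subnKC // addnC -divn_eq.
Qed.

Lemma mem_Pseq_par u v x : edge u v -> x \in P v -> (x %% p ^ depth u)%N \in P u.
Proof. by move=> uv; rewrite (mem_Pseq _ uv) => /andP[]. Qed.

(** The blocks of the children of [u] exhaust {0, ..., p-1}, so any leading digit added to an entry
    of [P u] falls to some child. *)
Lemma Pseq_cover k x : (x < p ^ k)%N -> exists2 v, depth v = k & x \in P v.
Proof.
elim: k x => [|k IH] x ltx.
  exists rho; first exact: depth_root.
  by rewrite Pseq_root // inE; move: ltx; rewrite expn0; case: x.
have [u du xu] := IH (x %% p ^ k)%N (ltn_pmod _ (expn_p_gt0 hp k)).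
have : (x %/ p ^ k < \sum_(w <- S u) cin w)%N.
  by rewrite sum_cin ltn_divLR ?expn_p_gt0 // -expnS.
have uS : uniq (S u) by case: (hS u).
move=> /(block_exists rho uS)[w]; rewrite mem_S => uw h.
exists w; first by rewrite (depth_edge uw) du.
by rewrite (mem_Pseq _ uw) du xu (offset_edge uw).
Qed.

(** The low part of [x] belongs to both parents, which therefore agree by induction; then the
    leading digit lies in a single block. *)
Lemma Pseq_disjoint v v' x : depth v = depth v' -> x \in P v -> x \in P v' -> v = v'.
Proof.
move: x v'; elim/tree_ind: v => [|u v uv IH] x v'.
  by rewrite depth_root // => /esym/depth_eq0.
rewrite (depth_edge uv) => /esym/depthSP[u' uv' du'] xv xv'.
have eu : u = u'.
  apply: (IH (x %% p ^ depth u)%N) => //; first exact: mem_Pseq_par xv.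
  by rewrite -du'; exact: mem_Pseq_par xv'.
move: uv' xv xv'; rewrite -eu => uv'.
rewrite (mem_Pseq _ uv) (mem_Pseq _ uv') => /andP[_ h] /andP[_ h'].
apply: (@block_unique _ rho cin (S u) v v' (x %/ p ^ depth u)); rewrite ?mem_S //.
- by rewrite -(offset_edge uv).
- by rewrite -(offset_edge uv').
Qed.

(** * The permutation of the residues at each level *)

Definition vertex_of (k x : nat) : G :=
  xget rho [set v | depth v = k /\ x \in P v]%classic.

(** For [x] below p^k exactly one vertex of depth [k] qualifies in [vertex_of], so the cycles of
    [step k] are the [P v] of that depth. *)
Definition step (k x : nat) : nat := next (P (vertex_of k x)) x.

Lemma vertex_ofE v x : x \in P v -> vertex_of (depth v) x = v.
Proof.
move=> xv; have [] := @xgetPex _ rho [set w | depth w = depth v /\ x \in P w]%classic.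
  by exists v.
by move=> d xw; apply: Pseq_disjoint xw xv.
Qed.

Lemma stepE v x : x \in P v -> step (depth v) x = next (P v) x.
Proof. by move=> xv; rewrite /step vertex_ofE. Qed.

Lemma step_nth v i : (i < size (P v))%N ->
  step (depth v) (nth 0%N (P v) i) = nth 0%N (P v) (i.+1 %% size (P v)).
Proof.
by move=> lti; rewrite stepE ?mem_nth // next_nth_mod ?uniq_Pseq.
Qed.

Lemma step_lt k x : (x < p ^ k)%N -> (step k x < p ^ k)%N.
Proof.
move=> /Pseq_cover[v <- xv]; rewrite stepE //.
by apply: (allP (Pseq_lt v)); rewrite mem_next.
Qed.

Lemma step_inj k x y : (x < p ^ k)%N -> (y < p ^ k)%N -> step k x = step k y -> x = y.
Proof.
move=> /Pseq_cover[v dv xv] /Pseq_cover[w dw yw] e.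
have evw : v = w.
  apply: (@Pseq_disjoint v w (step k x)); rewrite ?dv //.
    by rewrite -dv stepE // mem_next.
  by rewrite e -dw stepE // mem_next.
move: e yw; rewrite -evw -dv => + yw; rewrite !stepE //.
exact: (can_inj (prev_next (uniq_Pseq v))).
Qed.

Lemma step_surj k y : (y < p ^ k)%N -> exists2 x, (x < p ^ k)%N & step k x = y.
Proof.
move=> /Pseq_cover[v <- yv]; exists (prev (P v) y).
  by apply: (allP (Pseq_lt v)); rewrite mem_prev.
by rewrite stepE ?mem_prev // next_prev // uniq_Pseq.
Qed.

Lemma step_nthE u v i : edge u v -> (i < size (P v))%N ->
  step (depth v) (nth 0%N (P v) i) =
  (step (depth u) (nth 0%N (P v) i %% p ^ depth u) + nth 0%N (E v) i * p ^ depth u)%N.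
Proof.
move=> uv lti; rewrite step_nth //.
move: lti => /(Pseq_index uv)[a [j [-> lta ltj]]].
rewrite (nth_Eseq uv) // (nth_Pseq uv) // (size_Pseq uv).
rewrite [in RHS](addnC (nth _ _ _)) modnMDl.
rewrite (modn_small (nth_Pseq_lt ltj)) step_nth //.
(* At the end of a block the next index is [(a.+1 %% cin v) * size (P u) + 0]: the low part returns
   to the start of [P u]. Otherwise the next index is in the same block. These are the two cases of
   [nth_Eseq]. *)
case: eqP => [ej|nj].
  rewrite -addnS ej modnn -mulSnr -muln_modl -[in LHS](addn0 (_ * _)%N).
  by rewrite (nth_Pseq uv) ?ltn_pmod ?cin_gt0 ?size_Pseq_gt0.
have ltj' : (j.+1 < size (P u))%N by lia.
rewrite -addnS (modn_small ltj') modn_small ?(nth_Pseq uv) //.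
by move: (size _) ltj' => r; nia.
Qed.

Lemma step_mod k x : (x < p ^ k.+1)%N -> (step k.+1 x %% p ^ k)%N = step k (x %% p ^ k).
Proof.
move=> ltx; have [v dv /(nthP 0%N)[i lti ei]] := Pseq_cover ltx.
have [u uv du] := depthSP dv.
rewrite -dv -ei (step_nthE uv) // du addnC modnMDl modn_small //.
by apply: step_lt; rewrite ltn_pmod // expn_p_gt0.
Qed.

Lemma step_digit u v i : edge u v -> (i < size (P v))%N ->
  (step (depth v) (nth 0%N (P v) i) %/ p ^ depth u)%N = nth 0%N (E v) i.
Proof.
move=> uv lti; rewrite (step_nthE uv) // addnC divnMDl ?expn_p_gt0 //.
by rewrite divn_small ?addn0 // step_lt // ltn_pmod // expn_p_gt0.
Qed.

Lemma step1 x : (x < p)%N -> step 1 x = x.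
Proof.
rewrite -{1}(expn1 p) => /Pseq_cover[v dv xv].
have [u uv /depth_eq0 eu] := depthSP dv; rewrite eu in uv.
rewrite -dv stepE //.
have : size (P v) = 1%N by rewrite (size_Pseq uv) cin_root_child // Pseq_root.
case: (P v) xv => [|y [|z s]] // + _.
by rewrite inE => /eqP -> /=; rewrite eqxx.
Qed.

End CycleTree.

(** * Cyclic sequences and cycles of a map *)

Section Cycseq.
Variable T : choiceType.
Implicit Types s t : seq T.

Lemma to_cycseqP s t : to_cycseq s = to_cycseq t <-> exists i, t = rot i s.
Proof.
split=> [/eqquotP/asboolP //|h].
by apply/eqquotP/asboolP.
Qed.

Lemma repr_to_cycseq s : exists i, repr (to_cycseq s) = rot i s.
Proof. by apply/to_cycseqP; rewrite /to_cycseq reprK. Qed.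

Lemma cyc_length_to_cycseq s : cyc_length (to_cycseq s) = size s.
Proof. by rewrite /cyc_length; have [i ->] := repr_to_cycseq s; rewrite size_rot. Qed.

Lemma mem_to_cycseq s x : (x \in (repr (to_cycseq s) : seq T)) = (x \in s).
Proof. by have [i ->] := repr_to_cycseq s; rewrite mem_rot. Qed.

(** Both cycles are trajectories of [x]; were [s] shorter, the trajectory would return to [x] too
    early and [x] would recur in [t]. *)
Lemma fcycle_unique (f : T -> T) x s t :
  uniq (x :: s) -> uniq (x :: t) -> fcycle f (x :: s) -> fcycle f (x :: t) -> s = t.
Proof.
wlog le : s t / (size s <= size t)%N => [th us ut cs ct|].
  by case/orP: (leq_total (size s) (size t)) => le; [|apply/esym]; exact: th.
move=> us ut /fpathP[m es] /fpathP[n et].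
have [sm sn] : m = (size s).+1 /\ n = (size t).+1.
  by rewrite -!(size_rcons _ x) es et !size_traject.
have iterE u l : rcons u x = traject f (f x) (size u).+1 -> (l < size u)%N ->
    iter l.+1 f x = nth (f x) u l.
  move=> eu ltl.
  have : nth (f x) (rcons u x) l = nth (f x) (traject f (f x) (size u).+1) l.
    by rewrite eu.
  by rewrite nth_rcons ltl nth_traject -?iterSr // ltnS ltnW.
have [lt|ge] := ltnP (size s) (size t).
  have fx : iter (size s).+1 f x = x.
    by have := congr1 (last x) es; rewrite last_rcons sm last_traject => <-.
  rewrite sn in et; have := iterE t _ et lt; rewrite fx => ex.
  by move: ut => /= /andP[]; rewrite {1}ex mem_nth.
have e : size s = size t by apply/eqP; rewrite eqn_leq le.
by have := etrans es (congr1 _ (etrans sm (congr1 S e))); rewrite -sn -et => /rcons_inj[].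
Qed.

End Cycseq.

Lemma absz_mod_lt (j : int) (n : nat) : (0 < n)%N -> (`|(j %% n%:Z)%Z| < n)%N.
Proof.
move=> n0; have : (j %% n%:Z < n%:Z)%Z by rewrite ltz_pmod.
have : (0 <= j %% n%:Z)%Z by rewrite modz_ge0 // eqz_nat -lt0n.
by case: (j %% _)%Z.
Qed.

(** * The isomorphism with the tree of cycles *)

Section Realization.
Variables (p : nat) (hp : (1 < p)%N) (G : digraph) (rho : G) (c : G -> G -> nat).
Hypothesis hG : cycle_tree p rho c.
Variable S : G -> seq G.
Hypothesis hS : forall v, children_list v (S v).

Local Notation par := (par rho).
Local Notation depth := (depth rho).
Local Notation P := (Pseq p rho c S).
Local Notation E := (Eseq rho c S).
Local Notation step := (step p rho c S).

(** [step_mod] makes the maps [step k] coherent, and their injectivity and surjectivity pass to the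
    limit. *)
Lemma step_perm_exists : exists f g : padic p -> padic p,
  [/\ cancel f g, cancel g f & forall k n, res k (f n) = step k (res k n)].
Proof.
have f_ex (n : padic p) : exists m : padic p, forall k, res k m = step k (res k n).
  apply: (padic_lim hp (r := fun k => step k (res k n))) => k.
    by apply: (step_lt hp hG hS); exact: ltn_res.
  by rewrite (step_mod hp hG hS) ?ltn_res // resS.
have [f fE] := choice f_ex.
have finj : injective f.
  move=> m n e; apply: res_inj => k.
  by apply: (step_inj hp hG hS (k := k)); rewrite ?ltn_res // -!fE e.
have f_surj (n : padic p) : exists m, f m = n.
  have r_ex : forall k, exists x, (x < p ^ k)%N /\ step k x = res k n.
    by move=> k; have [x] := step_surj hp hG hS (ltn_res hp k n); exists x.
  have [r rE] := choice r_ex; have [|k|m mE] := @padic_lim p hp r.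
    by move=> k; case: (rE k).
    (* The chosen preimages are coherent: the reduction of [r k.+1] and [r k] have the same image
       under the injective [step k]. *)
    apply: (step_inj hp hG hS (k := k)); first by rewrite ltn_pmod // expn_p_gt0.
      by case: (rE k).
    rewrite -(step_mod hp hG hS); last by case: (rE k.+1).
    by case: (rE k.+1) => _ ->; case: (rE k) => _ ->; exact: resS.
  exists m; apply: res_inj => k; rewrite fE mE; by case: (rE k).
have [g gK] := choice f_surj; by exists f, g; split=> // n; apply: finj; rewrite gK.
Qed.

Variables f g : padic p -> padic p.
Hypotheses (fK : cancel f g) (gK : cancel g f).
Hypothesis f_step : forall k n, res k (f n) = step k (res k n).

Lemma f_res k m n : res k m = res k n <-> res k (f m) = res k (f n).
Proof.
rewrite !f_step; split=> [-> //|].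
by apply: (step_inj hp hG hS (k := k)); exact: ltn_res.
Qed.

Lemma f_res1 n : res 1 (f n) = res 1 n.
Proof.
rewrite f_step; apply: (step1 hp hG hS).
by rewrite -[X in (_ < X)%N](expn1 p); exact: (ltn_res hp 1 n).
Qed.

Lemma f_digit n : digit (f n) = digit n.
Proof. by apply/(digit_eqP hp); exact: f_res1. Qed.

Lemma f_padic_perm : padic_perm f.
Proof.
split=> [|n|k m n _]; first by exists g.
  by apply/(congr_powP hp); exact: f_res1.
by rewrite !(congr_powP hp); exact: f_res.
Qed.

Let D : digit_family p := psi (conj_system f g).

Lemma D_defines : defines_table rho c S D.
Proof.
move=> v i a nv lti; have [treeG _ _ _] := hG.
have uv := par_edge treeG nv; rewrite (depth_edge hG uv) /=.
(* The term in [a] vanishes at this level; this is why the table is well defined. *)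
have rE : res (depth (par v)).+1
    ((nth 0%N (P v) i)%:R + a * p%:R ^+ (depth (par v)).+1 : padic p) = nth 0%N (P v) i.
  have lt := nth_Pseq_lt hp hG hS lti; rewrite (depth_edge hG uv) in lt.
  have ap : a * p%:R ^+ (depth (par v)).+1 \in pow_ideal (depth (par v)).+1.
    by rewrite unfold_in; apply/asboolP; exists a.
  move/(pow_idealP hp): ap => ap.
  by rewrite (resD hp) ap addn0 (res_nat hp) !modn_small.
rewrite /D (psi_conj hp gK f_digit) (psi_base_res hp) f_step rE.
by rewrite -(depth_edge hG uv) (step_digit hp hG hS).
Qed.

(** Every [n] has the form P(v)[i] + a p^(j+1) with [v] of depth j+1, so the defining equations
    prescribe each entry. *)
Lemma D_unique D' : defines_table rho c S D' -> D' = D.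
Proof.
move=> hD'; apply/funext => n; apply/funext => j; apply: val_inj => /=.
have [v dv /(nthP 0%N)[i lti ei]] := Pseq_cover hp hG hS (ltn_res hp j.+1 n).
have nv : v <> rho.
  by move=> ev; rewrite ev depth_root in dv; first by []; case: hG.
have : n - (res j.+1 n)%:R \in pow_ideal j.+1.
  apply/(pow_idealP hp)/(resB_eq0 hp).
  by rewrite (res_nat hp) modn_small ?ltn_res.
rewrite unfold_in => /asboolP[a /eqP]; rewrite subr_eq addrC -ei -dv => /eqP nE.
have -> : j = (depth v).-1 by rewrite dv.
by rewrite nE hD' // D_defines.
Qed.

(** * The cycles of the induced maps *)

Lemma cls_repr k (y : padic_mod p k) : cls k (repr y) = y.
Proof. exact: reprK. Qed.

Lemma induced_cls k n : induced f (cls k n) = cls k (f n).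
Proof.
apply/(cls_eqP hp)/(f_res _ _ _).1/(cls_eqP hp).
exact: cls_repr.
Qed.

Definition cycle_seq v : seq (padic_mod p (depth v)) :=
  [seq cls (depth v) (x%:R : padic p) | x <- P v].

Lemma res_nat_small v x : x \in P v -> res (depth v) (x%:R : padic p) = x.
Proof.
by move=> xv; rewrite (res_nat hp) modn_small // (allP (Pseq_lt hp hG hS v)).
Qed.

Lemma mem_cycle_seq v n : (cls (depth v) n \in cycle_seq v) = (res (depth v) n \in P v).
Proof.
apply/mapP/idP => [[x xv /(cls_eqP hp) ->]|nv]; first by rewrite res_nat_small.
by exists (res (depth v) n) => //; apply/(cls_eqP hp); rewrite res_nat_small.
Qed.

Lemma uniq_cycle_seq v : uniq (cycle_seq v).
Proof.
rewrite map_inj_in_uniq ?(uniq_Pseq hp hG hS) // => x y xv yv /(cls_eqP hp).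
by rewrite !res_nat_small.
Qed.

Lemma fcycle_cycle_seq v : fcycle (@induced p f (depth v)) (cycle_seq v).
Proof.
rewrite cycle_map; apply/(sub_in_cycle _ (allss _) (cycle_next (uniq_Pseq hp hG hS v))).
move=> x y xv yv /= /eqP <-; apply/eqP; rewrite induced_cls.
apply/(cls_eqP hp); rewrite f_step !res_nat_small ?mem_next //.
by rewrite (stepE hp hG hS).
Qed.

Lemma size_cycle_seq v : size (cycle_seq v) = size (P v).
Proof. exact: size_map. Qed.

Lemma cycle_seq_is_cycle v : is_cycle (@induced p f (depth v)) (to_cycseq (cycle_seq v)).
Proof.
exists (cycle_seq v); split=> //; first by rewrite size_cycle_seq (size_Pseq_gt0 hG).
  exact: uniq_cycle_seq.
exact: fcycle_cycle_seq.
Qed.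

Definition phi (v : G) : cycle_graph f :=
  exist _ (existT (fun k => cycseq (padic_mod p k) : Type) (depth v)
                  (to_cycseq (cycle_seq v)))
        (asboolT (cycle_seq_is_cycle v)).

Lemma phi_inj : injective phi.
Proof.
move=> v w /(congr1 val) e.
(* Membership is stated on the dependent pair, so that equal pairs can be compared without transport
   between levels. *)
pose mem_cyc (z : {k : nat & cycseq (padic_mod p k)}) n :=
  cls (tag z) n \in (repr (tagged z) : seq (padic_mod p (tag z))).
have dE : depth v = depth w := congr1 (@tag _ _) e.
have := congr1 (mem_cyc ^~ ((nth 0%N (P v) 0)%:R)) e.
have Pv : nth 0%N (P v) 0 \in P v by rewrite mem_nth // (size_Pseq_gt0 hG).
rewrite /mem_cyc /= !mem_to_cycseq !mem_cycle_seq res_nat_small // Pv.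
rewrite -dE res_nat_small // => /esym.
exact: (Pseq_disjoint hp hG hS).
Qed.

(** The vertex is the one whose [P] contains the residue of an entry of the given cycle; two cycles
    of one map through a common entry coincide. *)
Lemma phi_surj (x : cycle_graph f) : exists v, phi v = x.
Proof.
case: x => -[k sigma] hx; have /asboolP /= [s [es s0 us cs]] := hx.
case: s es s0 us cs => // y s es _ us cs.
have [v dv nv] := Pseq_cover hp hG hS (ltn_res hp k (repr y)).
exists v; apply: val_inj => /=; rewrite es.
clear sigma hx es; move: s y us cs nv; rewrite -dv => s y us cs nv; congr existT.
have /rot_to[i s' e] : y \in cycle_seq v by rewrite -[y](cls_repr y) mem_cycle_seq.
have -> : to_cycseq (cycle_seq v) = to_cycseq (y :: s').
  by apply/to_cycseqP; exists i.
congr (to_cycseq (_ :: _)); apply: (@fcycle_unique _ (@induced p f (depth v)) y) => //.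
- by rewrite -e rot_uniq uniq_cycle_seq.
- by rewrite -e rot_cycle fcycle_cycle_seq.
Qed.

Lemma phi_bij : bijective phi.
Proof.
have [psi psiK] := choice phi_surj.
by exists psi => // v; apply: phi_inj; rewrite psiK.
Qed.

(** Modulo p^(depth u), the sequence [P v] runs [cin v] times around [P u]. *)
Lemma nth_Pseq_mod u v i : edge u v ->
  (nth 0%N (P v) (i %% size (P v)) %% p ^ depth u)%N =
  nth 0%N (P u) (i %% size (P u)).
Proof.
move=> uv; have lt := ltn_pmod i (size_Pseq_gt0 hG S v).
have [a [j [ei lta ltj]]] := Pseq_index hG uv lt.
have -> : (i %% size (P u) = j)%N.
  rewrite -[RHS](modn_small ltj) -[RHS](modnMDl a) -ei modn_dvdm //.
  by rewrite (size_Pseq hG S uv) dvdn_mull.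
rewrite ei (nth_Pseq hG uv) // addnC modnMDl modn_small //.
exact: (nth_Pseq_lt hp hG hS).
Qed.

(** An edge of the tree gives aligned sequences, with shift 0. Conversely, the congruence at the
    single index 0 puts a common residue in [P u] and in the [P] of the parent of [v], so these
    vertices agree. *)
Lemma phi_edge u v : edge u v = edge (phi u) (phi v).
Proof.
apply/idP/asboolP => [uv|[dE [a [b [ea eb [i hi]]]]]].
  split; first exact: (depth_edge hG uv).
  exists [seq x%:R | x <- P u], [seq x%:R | x <- P v].
  split; [by rewrite -map_comp | by rewrite -map_comp |].
  exists 0 => j; rewrite add0r /= !size_map.
  have szu := size_Pseq_gt0 hG S u; have szv := size_Pseq_gt0 hG S v.
  (* One natural number serves both indices: the residue of [j] modulo the longer length, which is a
     multiple of the shorter. *)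
  have [l [-> ->]] : exists l : nat,
      `|(j %% (size (P u))%:Z)%Z|%N = (l %% size (P u))%N /\
      `|(j %% (size (P v))%:Z)%Z|%N = (l %% size (P v))%N.
    exists `|(j %% (size (P v))%:Z)%Z|%N; split; last by rewrite modn_small ?absz_mod_lt.
    have -> : (j %% (size (P u))%:Z)%Z = ((j %% (size (P v))%:Z)%Z %% (size (P u))%:Z)%Z.
      rewrite [in LHS](divz_eq j (size (P v))) {2}(size_Pseq hG S uv).
      by rewrite PoszM mulrA modzMDl.
    have : (0 <= j %% (size (P v))%:Z)%Z by rewrite modz_ge0 // eqz_nat -lt0n.
    by case: (j %% _)%Z => // n _; rewrite modz_nat.
  rewrite !(nth_map 0%N) ?ltn_pmod //.
  apply/(congr_powP hp); rewrite !(res_nat hp) (nth_Pseq_mod l uv).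
  by rewrite modn_small // (nth_Pseq_lt hp hG hS) // ltn_pmod.
rewrite /level /= in dE; rewrite /level /= in hi.
have /to_cycseqP[ia aE] : to_cycseq (cycle_seq u) = _ := ea.
have /to_cycseqP[ib bE] : to_cycseq (cycle_seq v) = _ := eb.
have sa : (0 < size a)%N.
  by rewrite -(size_map (cls (depth u))) aE size_rot size_cycle_seq (size_Pseq_gt0 hG).
have sb : (0 < size b)%N.
  by rewrite -(size_map (cls (depth v))) bE size_rot size_cycle_seq (size_Pseq_gt0 hG).
have := mem_nth 0 (absz_mod_lt 0 sa); have := mem_nth 0 (absz_mod_lt (i + 0) sb).
move: (hi 0) => /(congr_powP hp).
set m := nth 0 a _; set n := nth 0 b _ => emn.
move=> /(map_f (cls (depth v))); rewrite bE mem_rot mem_cycle_seq => nv.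
move=> /(map_f (cls (depth u))); rewrite aE mem_rot mem_cycle_seq emn => nu.
have [w wv dw] := depthSP hG dE.
have := mem_Pseq_par hp hG hS wv nv; rewrite dw dE (resS hp) => nw.
by rewrite (Pseq_disjoint hp hG hS (esym dw) nu nw).
Qed.

Lemma phi_label u v : edge u v -> (c u v)%:R = cycle_label (phi u) (phi v).
Proof.
move=> uv; rewrite /cycle_label /= !cyc_length_to_cycseq !size_cycle_seq.
rewrite (size_Pseq hG S uv) (cin_edge hG uv) natrM mulfK //.
by rewrite Num.Theory.pnatr_eq0 -lt0n (size_Pseq_gt0 hG).
Qed.

Lemma phi_iso : labelled_iso (fun u v => (c u v)%:R) (@cycle_label p f) phi.
Proof. split; [exact: phi_bij | exact: phi_edge | exact: phi_label]. Qed.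

End Realization.

Theorem theorem8p4 (p : nat) (hp : (1 < p)%N)
    (G : digraph) (rho : G) (c : G -> G -> nat) (hG : cycle_tree p rho c)
    (S : G -> seq G) (hS : forall v, children_list v (S v)) :
  (forall v, size (Eseq rho c S v) = size (Pseq p rho c S v) /\
             all (fun e => (e < p)%N) (Eseq rho c S v)) /\
  exists D : digit_family p,
    [/\ defines_table rho c S D,
        forall D' : digit_family p, defines_table rho c S D' -> D' = D,
        digit_table D,
        block_property D &
        exists F : fibred p,
          [/\ padic_system F /\ canonical_form F,
              psi F = D,
              forall F' : fibred p,
                padic_system F' -> canonical_form F' -> psi F' = D -> F' = F &
              let f := pi_sys F (base_system p) in
              [/\ padic_perm f,
                  exists phi : G -> cycle_graph f,
                    (forall v : G, val (phi v) =
                       existT (fun k => cycseq (padic_mod p k) : Type) (depth rho v)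
                         (to_cycseq [seq cls (depth rho v) (x%:R : padic p)
                                    | x <- Pseq p rho c S v])) /\
                    labelled_iso (fun u v => (c u v)%:R) (@cycle_label p f) phi &
                  labelled_isomorphic (fun u v : G => (c u v)%:R) (@cycle_label p f)]]].
Proof.
split=> [v|]; first by split; [exact: (size_Eseq hG) | exact: (Eseq_lt hp hG hS)].
have [f [g [fK gK f_step]]] := step_perm_exists hp hG hS.
have fr := f_res hp hG hS f_step; have fd := f_digit hp hG hS f_step.
exists (psi (conj_system f g)); split=> //.
- exact: (D_defines hp hG hS gK f_step).
- exact: (D_unique hp hG hS gK f_step).
- exact: (conj_block hp gK fr fd).
exists (conj_system f g); split=> //.
- by split; [exact: (conj_block hp gK fr fd) | exact: conj_canonical].
- by move=> F' _; exact: (conj_unique hp fK gK fd).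
(* The type of the cycle graph depends on this map, so it is replaced by [f] before the isomorphism
   is supplied. *)
have -> : pi_sys (conj_system f g) (base_system p) = f.
  exact: (pi_sys_conj hp gK fd).
move=> /=; have iso := phi_iso hp hG hS f_step.
split; first exact: (f_padic_perm hp hG hS fK gK f_step).
  by exists (phi hp hG hS f_step).
by exists (phi hp hG hS f_step).
Qed.
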